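(* Let $R$ be a $2$-torsion free $\sigma$-prime ring, where $\sigma$ is an involution of $R$, and let $U$ be a $\sigma$-square closed Lie ideal of $R$. If $d:R\to R$ is an additive mapping which satisfies $d(u^2)=2ud(u)$ for all $u\in U$, then $d(uv)=ud(v)+vd(u)$ for all $u,v\in U$.
   Context: Rings are associative and not assumed to have an identity element. $[x,y]=xy-yx$. $R$ is $2$-torsion free if $2x=0$ with $x\in R$ implies $x=0$. An involution $\sigma$ of $R$ is an additive map $\sigma:R\to R$ with $\sigma(xy)=\sigma(y)\sigma(x)$ and $\sigma(\sigma(x))=x$ for all $x,y\in R$. A ring $R$ with involution $\sigma$ is $\sigma$-prime if, for all $a,b\in R$, $aRb=aR\sigma(b)=0$ implies $a=0$ or $b=0$. A Lie ideal of $R$ is an additive subgroup $U$ of $R$ such that $[u,r]\in U$ for all $u\in U$, $r\in R$. A $\sigma$-Lie ideal is a Lie ideal $U$ with $\sigma(U)=U$. A $\sigma$-square closed Lie ideal is a $\sigma$-Lie ideal $U$ such that $u^2\in U$ for all $u\in U$. *)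

(* Defs.v *)
From HB Require Import structures.
From mathcomp Require Import all_boot all_algebra.
From mathcomp Require Import classical_sets.

Set Implicit Arguments.
Unset Strict Implicit.
Unset Printing Implicit Defensive.

Import GRing.Theory.

Local Open Scope classical_set_scope.
Local Open Scope ring_scope.

(* The ring structures of ssralg all have a unit element. Here a ring without
   unit is an additive group that is also a multiplicative semigroup, with
   distributivity; mulgA and the lemmas on zmodType apply to it. The unital
   case is not excluded. *)
HB.mixin Record ZmoduleSemigroup_isRng R of GRing.Zmodule R & Semigroup R := {
  rngDl : left_distributive (@monoid.mul R) +%R;
  rngDr : right_distributive (@monoid.mul R) +%R
}.

#[short(type="rngType")]
HB.structure Definition Rng :=
  {R of ZmoduleSemigroup_isRng R & GRing.Zmodule R & Semigroup R}.

(* The ring_scope notation "x * y" elaborates to GRing.mul, hence a new symbol. *)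
Notation "x ** y" := (monoid.mul x y)
  (at level 40, left associativity) : ring_scope.

Definition lie_bracket (R : rngType) (x y : R) : R := x ** y - y ** x.

Definition two_torsion_free (R : rngType) : Prop :=
  forall x : R, x *+ 2 = 0 -> x = 0.

Definition is_involution (R : rngType) (sigma : {additive R -> R}) : Prop :=
  {morph sigma : x y / x ** y >-> y ** x} /\ involutive sigma.

Definition sigma_prime (R : rngType) (sigma : R -> R) : Prop :=
  forall a b : R,
    (forall r, a ** r ** b = 0) -> (forall r, a ** r ** sigma b = 0) ->
    a = 0 \/ b = 0.

Definition additive_subgroup (R : rngType) (U : set R) : Prop :=
  U 0 /\ forall x y, U x -> U y -> U (x - y).

Definition lie_ideal (R : rngType) (U : set R) : Prop :=
  additive_subgroup U /\ forall u r, U u -> U (lie_bracket u r).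

Definition sigma_lie_ideal (R : rngType) (sigma : R -> R) (U : set R) : Prop :=
  lie_ideal U /\ sigma @` U = U.

Definition sigma_square_closed_lie_ideal
    (R : rngType) (sigma : R -> R) (U : set R) : Prop :=
  sigma_lie_ideal sigma U /\ forall u, U u -> U (u ** u).

(* Main.v *)
(* On [U] the hypothesis gives [x, y] d(xy) = x [x, y] d(y) + y [x, y] d(x), so
   that a commutator a = [x, y] satisfies a d(a) = 0 and a a v d(a) = 0 for all v
   in [U]. A sigma-prime ring has a prime ideal P, not of characteristic 2, with
   P and sigma(P) meeting in 0. If [U] is not commutative modulo P, it contains
   an ideal not inside P, and the identities force a or d(a) into P. A group is
   not the union of two proper subgroups, so d([U, U]) lies in P, likewise in
   sigma(P), hence is 0. Then d(uv) = d(vu), and linearizing d(u^2) = 2 u d(u)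
   concludes. *)
Require Import Defs.
From mathcomp Require Import all_boot all_algebra.
From mathcomp Require Import classical_sets.
From Stdlib Require Import Classical.
Local Open Scope ring_scope.

Set Implicit Arguments.
Unset Strict Implicit.
Unset Printing Implicit Defensive.

Import GRing.Theory.

(** * Deciding identities in rings without unit, by reflection *)

Inductive rng_expr :=
| RVar of nat
| RZero
| RAdd of rng_expr & rng_expr
| ROpp of rng_expr
| RMuln of rng_expr & nat
| RMul of rng_expr & rng_expr.

(* A nonempty word of variables: there is no unit to interpret the empty one. *)
Definition rng_word : Type := nat * seq nat.

Definition word_mul (v w : rng_word) : rng_word := (v.1, v.2 ++ w.1 :: w.2).

Definition words_mul (s t : seq rng_word) : seq rng_word :=
  flatten [seq [seq word_mul v w | w <- t] | v <- s].

(* The words with a plus sign and those with a minus sign in the expansion. *)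
Fixpoint expand (e : rng_expr) : seq rng_word * seq rng_word :=
  match e with
  | RVar i => ([:: (i, [::])], [::])
  | RZero => ([::], [::])
  | RAdd e1 e2 =>
      let: (p1, n1) := expand e1 in
      let: (p2, n2) := expand e2 in (p1 ++ p2, n1 ++ n2)
  | ROpp e1 => let: (p1, n1) := expand e1 in (n1, p1)
  | RMuln e1 k =>
      let: (p1, n1) := expand e1 in (flatten (nseq k p1), flatten (nseq k n1))
  | RMul e1 e2 =>
      let: (p1, n1) := expand e1 in
      let: (p2, n2) := expand e2 in
      (words_mul p1 p2 ++ words_mul n1 n2, words_mul p1 n2 ++ words_mul n1 p2)
  end.

Section RngNormalization.
Variables (R : rngType) (env : seq R).
Implicit Types (x y z : R) (e : rng_expr) (v w : rng_word) (s t : seq rng_word).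

Lemma rng_mul0r x : 0 ** x = 0.
Proof. by apply: (addrI (0 ** x)); rewrite -rngDl !addr0. Qed.

Lemma rng_mulr0 x : x ** 0 = 0.
Proof. by apply: (addrI (x ** 0)); rewrite -rngDr !addr0. Qed.

Lemma rng_mulNr x y : (- x) ** y = - (x ** y).
Proof. by apply: (addrI (x ** y)); rewrite -rngDl !subrr rng_mul0r. Qed.

Lemma rng_mulrN x y : x ** (- y) = - (x ** y).
Proof. by apply: (addrI (x ** y)); rewrite -rngDr !subrr rng_mulr0. Qed.

Fixpoint rng_eval e : R :=
  match e with
  | RVar i => nth (0 : R) env i
  | RZero => 0
  | RAdd e1 e2 => rng_eval e1 + rng_eval e2
  | ROpp e1 => - rng_eval e1
  | RMuln e1 n => rng_eval e1 *+ n
  | RMul e1 e2 => rng_eval e1 ** rng_eval e2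
  end.

Definition word_eval w : R :=
  foldl (fun x i => x ** nth (0 : R) env i) (nth (0 : R) env w.1) w.2.

Definition words_eval s : R := \sum_(w <- s) word_eval w.

Lemma word_eval_mul v w : word_eval (word_mul v w) = word_eval v ** word_eval w.
Proof.
case: v w => i s [j t]; rewrite /word_eval /word_mul /= foldl_cat /=.
elim/last_ind: t => [|t k IHt] //=.
by rewrite -!cats1 !foldl_cat /= IHt mulgA.
Qed.

Lemma words_eval_cat s t : words_eval (s ++ t) = words_eval s + words_eval t.
Proof. exact: big_cat. Qed.

Lemma words_eval_mul s t :
  words_eval (words_mul s t) = words_eval s ** words_eval t.
Proof.
elim: s => [|v s IHs]; first by rewrite /words_eval !big_nil rng_mul0r.
rewrite /words_mul /= words_eval_cat IHs [words_eval (v :: s)]big_cons rngDl.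
congr (_ + _); elim: t {IHs} => [|w t IHt].
  by rewrite /words_eval !big_nil rng_mulr0.
by rewrite /words_eval /= !big_cons rngDr word_eval_mul -IHt.
Qed.

Lemma rng_eval_expand e :
  rng_eval e = words_eval (expand e).1 - words_eval (expand e).2.
Proof.
elim: e => [i||e1 IH1 e2 IH2|e1 IH1|e1 IH1 k|e1 IH1 e2 IH2] /=.
- by rewrite /words_eval big_seq1 big_nil subr0.
- by rewrite /words_eval big_nil subr0.
- rewrite IH1 IH2; case: (expand e1) (expand e2) => [p1 n1] [p2 n2] /=.
  by rewrite !words_eval_cat opprD addrACA.
- by rewrite IH1; case: (expand e1) => p1 n1 /=; rewrite opprB.
- rewrite IH1; case: (expand e1) => p1 n1 /=.
  elim: k => [|k IHk]; first by rewrite /words_eval big_nil subr0.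
  by rewrite mulrS IHk /= !words_eval_cat opprD addrACA.
- rewrite IH1 IH2; case: (expand e1) (expand e2) => [p1 n1] [p2 n2] /=.
  rewrite !words_eval_cat !words_eval_mul.
  rewrite rngDl !rngDr !rng_mulrN !rng_mulNr opprK opprD [RHS]addrACA.
  by rewrite [X in _ = _ + X]addrC.
Qed.

(** Moving the negative words across the equality leaves plain sums of words on both sides, so a
    permutation test suffices and nothing has to be cancelled. *)
Lemma rng_eval_eq e1 e2 :
  perm_eq ((expand e1).1 ++ (expand e2).2) ((expand e2).1 ++ (expand e1).2) ->
  rng_eval e1 = rng_eval e2.
Proof.
move=> eq_e; apply/eqP; rewrite !rng_eval_expand subr_eq addrAC eq_sym subr_eq.
by rewrite -!words_eval_cat [_ == _]eq_sym /words_eval (perm_big _ eq_e).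
Qed.

End RngNormalization.

(* Atoms are compared up to unification, since the operations inside them may
   come from different but convertible structure instances. *)
Ltac rng_index x env :=
  match env with
  | ?y :: _ => let _ := match goal with _ => unify x y end in constr:(O)
  | _ :: ?env' => let n := rng_index x env' in constr:(S n)
  end.

Ltac rng_atoms t env :=
  lazymatch t with
  | 0 => env
  | ?a + ?b => let env' := rng_atoms a env in rng_atoms b env'
  | - ?a => rng_atoms a env
  | ?a *+ _ => rng_atoms a env
  | ?a ** ?b => let env' := rng_atoms a env in rng_atoms b env'
  | _ => match constr:(tt) with
         | _ => let _ := rng_index t env in env
         | _ => constr:(t :: env)
         end
  end.

Ltac rng_reify t env :=
  lazymatch t with
  | 0 => constr:(RZero)
  | ?a + ?b =>
      let e1 := rng_reify a env in let e2 := rng_reify b env in constr:(RAdd e1 e2)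
  | - ?a => let e1 := rng_reify a env in constr:(ROpp e1)
  | ?a *+ ?n => let e1 := rng_reify a env in constr:(RMuln e1 n)
  | ?a ** ?b =>
      let e1 := rng_reify a env in let e2 := rng_reify b env in constr:(RMul e1 e2)
  | _ => let i := rng_index t env in constr:(RVar i)
  end.

Ltac rng :=
  rewrite /lie_bracket;
  lazymatch goal with
  | |- @eq ?T ?x ?y =>
      let env0 := rng_atoms x (@nil T) in
      let env := rng_atoms y env0 in
      let e1 := rng_reify x env in
      let e2 := rng_reify y env in
      apply: (@rng_eval_eq _ env e1 e2); vm_compute; reflexivity
  end.


(** For proofs by linear combination: known equations are subtracted from or added to the goal until
    [rng] proves what remains. *)
Lemma eq_subl (V : zmodType) (l r a b : V) : l = r -> a - l = b - r -> a = b.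
Proof. by move=> -> /addIr. Qed.

Lemma eq_addl (V : zmodType) (l r a b : V) : l = r -> a + l = b + r -> a = b.
Proof. by move=> -> /addIr. Qed.

Lemma mulg_congl (R : rngType) (x l r : R) : l = r -> x ** l = x ** r.
Proof. by move->. Qed.

(** * Identities for a Jordan left derivation on a square closed Lie ideal *)

Section JordanLeftDerivation.
Variables (R : rngType) (U : set R) (d : {additive R -> R}).
Hypothesis tfR : two_torsion_free R.
Hypothesis lieU : lie_ideal U.
Hypothesis sqU : forall u, U u -> U (u ** u).
Hypothesis d_sq : forall u, U u -> d (u ** u) = (u ** d u) *+ 2.
Implicit Types u v w x y : R.

Lemma half_inj x y : x *+ 2 = y *+ 2 -> x = y.
Proof.
move=> e; apply/eqP; rewrite -subr_eq0; apply/eqP/tfR.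
by rewrite mulrnBl e subrr.
Qed.

Lemma lieB u v : U u -> U v -> U (u - v).
Proof. by case: lieU => [[_ UB] _]; apply: UB. Qed.

Lemma lieD u v : U u -> U v -> U (u + v).
Proof.
case: lieU => [[U0 UB] _] Uu Uv.
have -> : u + v = u - (0 - v) by rng.
exact: (UB _ _ Uu (UB _ _ U0 Uv)).
Qed.

Lemma lie_br u x : U u -> U (lie_bracket u x).
Proof. by case: lieU => [_ UL]; apply: UL. Qed.

Lemma lie_anticomm u v : U u -> U v -> U (u ** v + v ** u).
Proof.
move=> Uu Uv.
have -> : u ** v + v ** u = (u + v) ** (u + v) - u ** u - v ** v by rng.
by do 2?apply: lieB; apply: sqU => //; apply: lieD.
Qed.

Lemma lie_mul2 u v : U u -> U v -> U (u ** v *+ 2).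
Proof.
move=> Uu Uv.
have -> : u ** v *+ 2 = (u ** v + v ** u) + lie_bracket u v by rng.
by apply: lieD; [apply: lie_anticomm | apply: lie_br].
Qed.

Lemma jordanD u v : U u -> U v ->
  d (u ** v) + d (v ** u) = (u ** d v + v ** d u) *+ 2.
Proof.
move=> Uu Uv; have := d_sq (lieD Uu Uv).
have -> : (u + v) ** (u + v) = u ** u + u ** v + v ** u + v ** v by rng.
rewrite !raddfD !d_sq // => e.
by apply: (eq_subl e); rng.
Qed.

(** With w = uv + vu, uw + wu = 2uvu + u^2 v + v u^2; [jordanD] evaluates [d] on uw + wu and on u^2
    v + v u^2. *)
Lemma jordan_uvu u v : U u -> U v ->
  d (u ** v ** u) = u ** u ** d v + u ** v ** d u *+ 3 - v ** u ** d u.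
Proof.
move=> Uu Uv; have Uw := lie_anticomm Uu Uv.
have := jordanD Uu Uw.
have -> : u ** (u ** v + v ** u) = u ** u ** v + u ** v ** u by rng.
have -> : (u ** v + v ** u) ** u = u ** v ** u + v ** (u ** u) by rng.
rewrite !raddfD jordanD // => e1.
have := jordanD (sqU Uu) Uv; rewrite d_sq // => e2.
apply: half_inj; apply: (eq_subl e1); apply: (eq_addl e2); rng.
Qed.

Lemma jordan_uvw u v w : U u -> U v -> U w ->
  d (u ** v ** w) + d (w ** v ** u) =
    (u ** w + w ** u) ** d v + u ** v ** d w *+ 3 + w ** v ** d u *+ 3
    - v ** u ** d w - v ** w ** d u.
Proof.
move=> Uu Uv Uw; have := jordan_uvu (lieD Uu Uw) Uv.
have -> : (u + w) ** v ** (u + w) =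
  u ** v ** u + u ** v ** w + w ** v ** u + w ** v ** w by rng.
rewrite !raddfD !jordan_uvu // => e.
by apply: (eq_subl e); rng.
Qed.

(* Compares two evaluations of d((uv)(uv) + (uv)vu): the first summand is a
   square and the second is u v^2 u. The word uv is doubled to stay in [U]. *)
Lemma bracket_d_mul u v : U u -> U v ->
  lie_bracket u v ** d (u ** v) =
    u ** lie_bracket u v ** d v + v ** lie_bracket u v ** d u.
Proof.
move=> Uu Uv; have Uw := lie_mul2 Uu Uv.
have := d_sq Uw.
have -> : (u ** v *+ 2) ** (u ** v *+ 2) = u ** v ** u ** v *+ 4 by rng.
rewrite !raddfMn => e1.
have := jordan_uvw Uu Uv Uw.
have -> : u ** v ** (u ** v *+ 2) = u ** v ** u ** v *+ 2 by rng.
have -> : u ** v *+ 2 ** v ** u = u ** (v ** v) ** u *+ 2 by rng.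
rewrite !raddfMn jordan_uvu ?d_sq //; last exact: sqU.
move=> e2; apply: half_inj; apply: half_inj.
by apply: (eq_subl e1); do 2!apply: (eq_addl e2); rng.
Qed.

(** Replacing v by v + u in [bracket_d_mul] keeps [u, v] and adds 2 u d(u) to d(uv). *)
Lemma bracket_mul_d u v : U u -> U v ->
  lie_bracket u v ** u ** d u = u ** lie_bracket u v ** d u.
Proof.
move=> Uu Uv; have := bracket_d_mul Uu (lieD Uv Uu).
rewrite rngDr !raddfD d_sq // => e.
have e0 := bracket_d_mul Uu Uv.
by apply: half_inj; apply: (eq_subl e); apply: (eq_addl e0); rng.
Qed.

(** [bracket_mul_d] says that [u, [u, v]] d(u) = 0, which is cubic in u. Comparing u + w with u - w
    and removing the part cubic in w isolates the part linear in w. *)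
Lemma bracket_mul_d_linear u v w : U u -> U v -> U w ->
  lie_bracket u (lie_bracket u v) ** d w
  + (lie_bracket u (lie_bracket w v) + lie_bracket w (lie_bracket u v)) ** d u = 0.
Proof.
move=> Uu Uv Uw.
have := bracket_mul_d (lieD Uu Uw) Uv; have := bracket_mul_d (lieB Uu Uw) Uv.
have := bracket_mul_d Uw Uv; rewrite raddfB raddfD => e0 e1 e2.
apply: half_inj; apply: (eq_addl e2); apply: (eq_subl e1).
by do 2!apply: (eq_subl e0); rng.
Qed.

(** * Annihilation identities for a commutator and its image under [d] *)

Section Commutator.
Variables (x y : R).
Hypotheses (Ux : U x) (Uy : U y).
Let a := lie_bracket x y.

Let Ua : U a. Proof. exact: lie_br. Qed.

(** Exchanging x and y in [bracket_d_mul] changes the sign of both the bracket and the right-hand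
    side, so a d(xy) = a d(yx). *)
Lemma commutator_mul_d : a ** d a = 0.
Proof.
rewrite /a [d _]raddfB; have e1 := bracket_d_mul Ux Uy; have e2 := bracket_d_mul Uy Ux.
by apply: (eq_subl e1); apply: (eq_subl e2); rng.
Qed.

Lemma commutator_sq_mul_d v : U v -> a ** a ** v ** d a = 0.
Proof.
move=> Uv; have e1 := bracket_mul_d Ua Uv; have e0 := commutator_mul_d.
(* Generalizing the commutator makes it a single atom for [rng]. *)
move: a e1 e0 => b e1 e0.
apply: (eq_addl e1); do 2!apply: (eq_subl (mulg_congl (b ** v) e0)).
by apply: (eq_addl (mulg_congl (v ** b) e0)); rng.
Qed.

(* The instance [w = a v + v a] of [bracket_mul_d_linear]. *)
Lemma commutator_avav_d v : U v ->
  a ** v ** a ** v ** d a *+ 2 *+ 2 =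
    (a ** a ** v ** a ** d v - a ** v ** (a ** a) ** d v *+ 2
     + v ** a ** (a ** a) ** d v) *+ 2.
Proof.
move=> Uv; have e1 := bracket_mul_d_linear Ua Uv (lie_anticomm Ua Uv).
have e0 := commutator_mul_d; have e2 := commutator_sq_mul_d Uv.
have e3 := commutator_sq_mul_d (sqU Uv); have e4 := jordanD Ua Uv.
move: a e1 e0 e2 e3 e4 => b; rewrite [d (_ + _)]raddfD => e1 e0 e2 e3 e4.
apply: (eq_addl e1).
(* The factor is [a, [a, v]], the coefficient of d(av + va) in [e1]. *)
apply: (eq_subl (mulg_congl (b ** b ** v - b ** v ** b *+ 2 + v ** b ** b) e4)).
do 3!apply: (eq_subl e3).
do 4!apply: (eq_subl (mulg_congl v e2)).
(* This factor collects the remaining terms that end in a d(a). *)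
have e := mulg_congl (- (b ** v ** v) *+ 2 + v ** b ** v
  + v ** (b ** v + v ** b) - (b ** v + v ** b) ** v *+ 2) e0.
by apply: (eq_subl e); rng.
Qed.

End Commutator.
End JordanLeftDerivation.

(** * Commutators modulo a prime ideal *)

Section PrimeIdeals.
Variable R : rngType.
Implicit Types (P : R -> Prop) (x y r : R).

Record tf_prime_ideal P : Prop := {
  ideal0 : P 0;
  idealB : forall x y, P x -> P y -> P (x - y);
  idealMl : forall r x, P x -> P (r ** x);
  idealMr : forall r x, P x -> P (x ** r);
  ideal_prime : forall x y, (forall r, P (x ** r ** y)) -> P x \/ P y;
  ideal_half : forall x, P (x *+ 2) -> P x }.

Variables (P : R -> Prop) (U : set R).
Hypotheses (primeP : tf_prime_ideal P) (lieU : lie_ideal U).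
Hypothesis sqU : forall u, U u -> U (u ** u).

Lemma idealN x : P x -> P (- x).
Proof.
by move=> Px; rewrite -sub0r; apply: (idealB primeP) => //; apply: (ideal0 primeP).
Qed.

Lemma idealD x y : P x -> P y -> P (x + y).
Proof.
by move=> Px Py; rewrite -[y]opprK; apply: (idealB primeP) => //; apply: idealN.
Qed.

Lemma idealMn x n : P x -> P (x *+ n).
Proof.
move=> Px; elim: n => [|n IHn]; first by rewrite mulr0n; apply: (ideal0 primeP).
by rewrite mulrS; apply: idealD.
Qed.

(* [U] contains the two-sided multiples of 2 [u0, v0], which leave the prime
   ideal. *)
Lemma lie_prime u0 v0 x y : U u0 -> U v0 -> ~ P (lie_bracket u0 v0) ->
  (forall w, U w -> P (x ** w ** y)) -> P x \/ P y.
Proof.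
move=> Uu0 Uv0 Pc Pxy; set c := lie_bracket u0 v0 in Pc.
(* The bracket with u0 is a derivation; the doubling puts the product of v0 and [u0, r] in [U]. *)
have Ucr r : U (c ** r *+ 2).
  have -> : c ** r *+ 2 =
    lie_bracket u0 (v0 ** r) *+ 2 - v0 ** lie_bracket u0 r *+ 2 by rewrite /c; rng.
  apply: (lieB lieU); last exact: (lie_mul2 lieU sqU Uv0 (lie_br lieU _ Uu0)).
  by rewrite mulr2n; apply: (lieD lieU); apply: (lie_br lieU).
have Urcs r s : U (r ** c ** s *+ 2).
  have -> : r ** c ** s *+ 2 = c ** (s ** r) *+ 2 - lie_bracket (c ** s *+ 2) r by rng.
  by apply: (lieB lieU) => //; apply: (lie_br lieU).
have Pxrcsy r s : P (x ** r ** c ** s ** y).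
  apply: (ideal_half primeP).
  have -> : x ** r ** c ** s ** y *+ 2 = x ** (r ** c ** s *+ 2) ** y by rng.
  exact: Pxy.
case: (classic (P x)) => [|nPx]; [by left | right].
have Pcsy s : P (c ** s ** y).
  have [r||] // := ideal_prime primeP (x := x) (y := c ** s ** y).
  by have -> : x ** r ** (c ** s ** y) = x ** r ** c ** s ** y by rng.
by have [] := ideal_prime primeP Pcsy.
Qed.

Variable d : {additive R -> R}.
Hypothesis tfR : two_torsion_free R.
Hypothesis d_sq : forall u, U u -> d (u ** u) = (u ** d u) *+ 2.

(** By [commutator_sq_mul_d], a^2 or d(a) is in [P]. If a^2 is, every term on the right of
    [commutator_avav_d] is in [P], hence so is a v a v d(a). Linearized, a v a w d(a) is skew in v
    and w modulo [P]. *)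
Lemma commutator_prime u0 v0 x y :
  U u0 -> U v0 -> ~ P (lie_bracket u0 v0) -> U x -> U y ->
  P (lie_bracket x y) \/ P (d (lie_bracket x y)).
Proof.
move=> Uu0 Uv0 Pc Ux Uy; set a := lie_bracket x y.
have Ua : U a by apply: (lie_br lieU).
have lp := lie_prime Uu0 Uv0 Pc.
have [v Uv|Paa|Pda] := lp (a ** a) (d a); last 1 first.
- by right.
- by rewrite (commutator_sq_mul_d tfR lieU sqU d_sq) //; apply: (ideal0 primeP).
have Pavav v : U v -> P (a ** v ** a ** v ** d a).
  move=> Uv; do 2!apply: (ideal_half primeP).
  rewrite (commutator_avav_d tfR lieU sqU d_sq) //; apply: idealMn.
  apply: idealD; last exact/(idealMr primeP)/(idealMl primeP).
  apply: (idealB primeP); first by do 3!apply: (idealMr primeP).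
  exact/idealMn/(idealMr primeP)/(idealMl primeP).
have Pavaw v w : U v -> U w ->
    P (a ** v ** a ** w ** d a + a ** w ** a ** v ** d a).
  move=> Uv Uw.
  have -> : a ** v ** a ** w ** d a + a ** w ** a ** v ** d a =
    a ** (v + w) ** a ** (v + w) ** d a - a ** v ** a ** v ** d a
    - a ** w ** a ** w ** d a by rng.
  by do 2?apply: (idealB primeP); apply: Pavav => //; apply: (lieD lieU).
pose g v w z := a ** v ** a ** w ** a ** z ** d a.
(* Skewness is applied to the pair 4 v a w and z; the factor 4 puts v a w in [U]. *)
have Pcyc v w z : U v -> U w -> U z -> P (g v w z + g z v w).
  move=> Uv Uw Uz; do 2!apply: (ideal_half primeP).
  have -> : (g v w z + g z v w) *+ 2 *+ 2 =
    a ** ((v ** a *+ 2) ** w *+ 2) ** a ** z ** d a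
    + a ** z ** a ** ((v ** a *+ 2) ** w *+ 2) ** d a by rewrite /g; rng.
  by apply: Pavaw => //; do 2?apply: (lie_mul2 lieU sqU).
(* Three cyclic shifts, each changing the sign modulo [P], give [g = - g]. *)
have Pg v w z : U v -> U w -> U z -> P (g v w z).
  move=> Uv Uw Uz; apply: (ideal_half primeP).
  have -> : g v w z *+ 2 = (g v w z + g z v w) - (g z v w + g w z v)
    + (g w z v + g v w z) by rng.
  by apply: idealD; [apply: (idealB primeP)|]; apply: Pcyc.
case: (classic (P a)) => [|nPa]; [by left | right].
have lpa y' : (forall w, U w -> P (a ** w ** y')) -> P y' by move=> /lp[].
(* As a is not in [P], three left factors a can be stripped from [g]. *)
apply: (lpa) => w Uw; apply: (lpa) => v Uv; apply: (lpa) => z Uz.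
by have := Pg z v w Uz Uv Uw; rewrite /g !mulgA.
Qed.

(** If u in [U] is outside [A], then for v in both [U] and [A] the sum v + u is outside [A], hence
    in [B] together with u, and so v is in [B]. *)
Lemma subgroup_union (A B : R -> Prop) :
  (forall u v, A u -> A v -> A (u - v)) ->
  (forall u v, B u -> B v -> B (u - v)) ->
  (forall u, U u -> A u \/ B u) ->
  (forall u, U u -> A u) \/ (forall u, U u -> B u).
Proof.
move=> AB BB UAB; case: (classic (forall u, U u -> A u)) => [|nA]; [by left | right].
have [u nAu] := not_all_ex_not _ _ nA; have {nA nAu} [Uu nAu] := imply_to_and _ _ nAu.
have Bu : B u by case: (UAB u Uu).
move=> v Uv; case: (UAB v Uv) => // Av; case: (UAB _ (lieD lieU Uv Uu)) => [Avu|Bvu].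
  by case: nAu; rewrite -(addKr v u) addrC; apply: AB.
by rewrite -(addrK u v); apply: BB.
Qed.

(** [subgroup_union] is used twice: in the second entry of the bracket with the first one fixed,
    then in the first entry. *)
Lemma d_commutator_prime u0 v0 x y :
  U u0 -> U v0 -> ~ P (lie_bracket u0 v0) -> U x -> U y ->
  P (d (lie_bracket x y)).
Proof.
move=> Uu0 Uv0 Pc Ux Uy.
have brBr u v w : lie_bracket u (v - w) = lie_bracket u v - lie_bracket u w by rng.
have brBl u v w : lie_bracket (v - w) u = lie_bracket v u - lie_bracket w u by rng.
pose A u := forall v, U v -> P (lie_bracket u v).
pose B u := forall v, U v -> P (d (lie_bracket u v)).
have AB u v : A u -> A v -> A (u - v).
  by move=> Au Av w Uw; rewrite brBl; apply: (idealB primeP); auto.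
have BB u v : B u -> B v -> B (u - v).
  by move=> Bu Bv w Uw; rewrite brBl raddfB; apply: (idealB primeP); auto.
have UAB u : U u -> A u \/ B u.
  move=> Uu; apply: subgroup_union => [v w Pv Pw|v w Pv Pw|v Uv].
  - by rewrite brBr; apply: (idealB primeP).
  - by rewrite brBr raddfB; apply: (idealB primeP).
  - exact: commutator_prime Pc Uu Uv.
case: (subgroup_union AB BB UAB) => [UA|UB]; last exact: UB.
by case: Pc; apply: UA.
Qed.

End PrimeIdeals.

(** * Prime ideals of a sigma-prime ring *)

Section SigmaPrime.
Variables (R : rngType) (sigma : {additive R -> R}).
Hypotheses (tfR : two_torsion_free R) (invS : is_involution sigma).
Hypothesis primeS : sigma_prime sigma.
Implicit Types a b x y : R.

Let sM x y : sigma (x ** y) = sigma y ** sigma x. Proof. by case: invS. Qed.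
Let sK : involutive sigma. Proof. by case: invS. Qed.

(** Both b = a r sigma(a) and sigma(b) = a sigma(r) sigma(a) start with a, so a R kills them on the
    left. Hence a = 0 or every such b vanishes, and then sigma-primeness applies to the pair a,
    a. *)
Lemma sigma_semiprime a : (forall r, a ** r ** a = 0) -> a = 0.
Proof.
move=> aRa; have aRsa r : a ** r ** sigma a = 0.
  have [||//|//] := primeS (a := a) (b := a ** r ** sigma a).
  - by move=> t; rewrite !mulgA aRa !rng_mul0r.
  - move=> t; rewrite !sM sK !mulgA.
    by rewrite aRa !rng_mul0r.
  - by move->; rewrite !rng_mul0r.
by have [] := primeS aRa aRsa.
Qed.

Lemma sigma_prime_pair :
  exists2 P : R -> Prop, tf_prime_ideal P & forall x, P x -> P (sigma x) -> x = 0.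
Proof.
case: (classic (exists a b, [/\ a <> 0, b <> 0 & forall r, a ** r ** b = 0]));
  last first.
  move=> primeR; exists (fun x => x = 0) => //; split => //.
  - by move=> x y -> ->; rewrite subrr.
  - by move=> r x ->; rewrite rng_mulr0.
  - by move=> r x ->; rewrite rng_mul0r.
  - move=> x y xRy; apply: NNPP => /not_or_and[x0 y0].
    by case: primeR; exists x, y.
(* [I] is the right annihilator of [a R] and [P] the left annihilator of [R I]. *)
case=> a [b [a0 b0 aRb]]; pose I x := forall r, a ** r ** x = 0.
have I_sI x : I x -> I (sigma x) -> x = 0.
  by move=> Ix Isx; have [] := primeS Ix Isx.
have IMl r x : I x -> I (r ** x) by move=> Ix t; rewrite mulgA -(mulgA a) Ix.
have IMr r x : I x -> I (x ** r) by move=> Ix t; rewrite mulgA Ix rng_mul0r.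
exists (fun x => forall r i, I i -> x ** r ** i = 0); first split.
- by move=> r i _; rewrite !rng_mul0r.
- by move=> x y Px Py r i Ii; rewrite !rngDl !rng_mulNr Px // Py // subrr.
- by move=> t x Px r i Ii; rewrite -!mulgA [x ** _]mulgA Px // rng_mulr0.
- by move=> t x Px r i Ii; rewrite -(mulgA x) Px.
- move=> x y Pxy; apply: NNPP => /not_or_and[nPx []] r i Ii.
  apply: NNPP => yri0; apply: nPx => s j Ij.
  (* For the second premise, x s j t sigma(y r i) and its image under [sigma] both lie in [I], so
     [I_sI] applies. *)
  have [||//|/yri0 //] := primeS (a := x ** s ** j) (b := y ** r ** i).
  - by move=> t; rewrite -[RHS](Pxy (s ** j ** t) r i Ii) !mulgA.
  - move=> t; apply: I_sI; first exact/IMr/IMr/IMl.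
    by rewrite sM sK; apply/IMr/IMl.
- move=> x Px r i Ii; apply: tfR; rewrite -[RHS](Px r i Ii); rng.
move=> x Px Psx.
have Ib : I b by [].
have sbRx r : sigma b ** r ** x = 0.
  by have := congr1 sigma (Psx (sigma r) b Ib); rewrite raddf0 !sM !sK mulgA.
have xRsb r : x ** r ** sigma b = 0.
  (* The middle factor sigma(b) t x of the product vanishes by [sbRx]. *)
  apply: sigma_semiprime => t.
  have -> : x ** r ** sigma b ** t ** (x ** r ** sigma b) =
    x ** r ** (sigma b ** t ** x) ** r ** sigma b by rng.
  by rewrite sbRx rng_mulr0 !rng_mul0r.
have xRb r : x ** r ** b = 0 by apply: Px.
by case: (primeS xRb xRsb) => // /b0.
Qed.

End SigmaPrime.

(** * Vanishing of [d] on commutators, and the conclusion *)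

Theorem theorem2 (R : rngType) (sigma : {additive R -> R}) (U : set R)
    (d : {additive R -> R}) :
  two_torsion_free R ->
  is_involution sigma ->
  sigma_prime sigma ->
  sigma_square_closed_lie_ideal sigma U ->
  (forall u, U u -> d (u ** u) = (u ** d u) *+ 2) ->
  forall u v, U u -> U v -> d (u ** v) = u ** d v + v ** d u.
Proof.
move=> tfR invS primeS [[lieU sU] sqU] d_sq.
have [sM sK] := invS.
have Us u : U u -> U (sigma u) by move=> Uu; rewrite -sU; exists u.
have [P primeP P_sP] := sigma_prime_pair tfR invS primeS.
pose Q x := P (sigma x).
have primeQ : tf_prime_ideal Q.
  rewrite /Q; split => [|x y|r x|r x|x y|x].
  - by rewrite raddf0; apply: (ideal0 primeP).
  - by rewrite raddfB; apply: (idealB primeP).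
  - by rewrite sM; apply: (idealMr primeP).
  - by rewrite sM; apply: (idealMl primeP).
  - move=> Qxy; apply/or_comm/(ideal_prime primeP) => r.
    by have := Qxy (sigma r); rewrite !sM sK mulgA.
  - by rewrite raddfMn; apply: (ideal_half primeP).
have s_br x y : sigma (lie_bracket x y) = lie_bracket (sigma y) (sigma x).
  by rewrite raddfB !sM.
have d_br u v : U u -> U v -> d (lie_bracket u v) = 0.
  move=> Uu Uv; apply: NNPP => dne.
  (* A bracket [x, y] outside [P] gives [sigma(y), sigma(x)] outside [Q], which would put d([u, v])
     in both [P] and [Q]. So all brackets of [U] lie in [P], and by stability of [U] under [sigma]
     also in [Q]: they are 0. *)
  have PU x y : U x -> U y -> P (lie_bracket x y).
    move=> Ux Uy; apply: NNPP => nP; case: dne; apply: P_sP.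
      exact: (d_commutator_prime primeP lieU sqU tfR d_sq Ux Uy nP).
    apply: (d_commutator_prime primeQ lieU sqU tfR d_sq (Us _ Uy) (Us _ Ux) _ Uu Uv).
    by rewrite /Q s_br !sK.
  case: dne; rewrite [lie_bracket u v]P_sP ?raddf0 ?s_br //; apply: PU => //; exact: Us.
move=> u v Uu Uv; apply: (half_inj tfR).
rewrite -(jordanD lieU d_sq) // mulr2n; congr (_ + _).
by apply/eqP; rewrite -subr_eq0 -raddfB; apply/eqP/d_br.
Qed.
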